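(* Let $k\ge2$ be even, $n\in\mathbb N$, $\epsilon\in(0,1)$, and let $\mathcal W$ be a family of channels from $[k]$ to a finite set $\mathcal Y$. If \[n\le\frac{k}{16\epsilon^2\max_{W\in\mathcal W}\|H(W)\|_F},\] then the $(n,\epsilon)$-minmax decoupled chi-square fluctuation satisfies \[\overline{\chi}^{(2)}(\mathcal W^n,\epsilon)=O\!\left(\frac{n^2\epsilon^4}{k}\cdot\frac{\max_{W\in\mathcal W}\|H(W)\|_F^2}{k}\right),\] where the implied constant is universal.
   Context: A channel $W$ from $[k]$ to $\mathcal Y$ is a stochastic matrix with entries $W(y\mid x)$; for a distribution $\mathbf p$ on $[k]$, $\mathbf p^W(y)=\sum_x\mathbf p(x)W(y\mid x)$. $\mathbf u$ is the uniform distribution on $[k]$, $d_{TV}$ total variation distance. For a family $\{\mathbf p_z: z\in\mathcal Z\}$ of distributions on $[k]$ and channel $W$, let $\delta_z^W(y)=(\mathbf p_z^W(y)-\mathbf u^W(y))/\mathbf u^W(y)$ and $\langle\delta^W_z,\delta^W_{z'}\rangle=\sum_{y:\mathbf u^W(y)>0}\mathbf u^W(y)\delta_z^W(y)\delta_{z'}^W(y)$. An almost $\epsilon$-perturbation (around $\mathbf u$) is a pair $\mathcal P_\zeta=(\{\mathbf p_z:z\in\mathcal Z\},\zeta)$ with $\zeta$ a distribution on $\mathcal Z$ such that $\Pr_{Z\sim\zeta}[d_{TV}(\mathbf p_Z,\mathbf u)\ge\epsilon]\ge 1/10$; let $\Upsilon_\epsilon$ be the set of these. For $W^n=(W_1,\dots,W_n)$,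 $\chi^{(2)}(W^n\mid\mathcal P_\zeta)=\log\mathbb E_{Z,Z'}\exp\big(\sum_{i=1}^n\langle\delta_Z^{W_i},\delta_{Z'}^{W_i}\rangle\big)$ with $Z,Z'$ i.i.d. $\sim\zeta$. The minmax decoupled chi-square fluctuation is $\overline{\chi}^{(2)}(\mathcal W^n,\epsilon)=\inf_{\mathcal P_\zeta\in\Upsilon_\epsilon}\sup_{W^n\in\mathcal W^n}\chi^{(2)}(W^n\mid\mathcal P_\zeta)$. $H(W)$ is the $(k/2)\times(k/2)$ matrix with entries $H(W)_{i_1,i_2}=\sum_{y}\frac{(W(y\mid 2i_1-1)-W(y\mid 2i_1))(W(y\mid 2i_2-1)-W(y\mid 2i_2))}{\sum_{x\in[k]}W(y\mid x)}$ (zero-denominator terms omitted); $\|\cdot\|_F$ is the Frobenius norm.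
   Formalization: The range ε∈(0,1) is restricted to ε∈(0,1/2]: for ε>1/2 the claim fails, e.g. for k=2 no distribution is at total variation distance ε from uniform, so the infimum is +∞, and for every even k≥4 suitable channel families violate the bound. *)

(* Defs.v *)
From HB Require Import structures.
From mathcomp Require Import all_boot all_order all_algebra.
From mathcomp Require Import all_classical all_reals all_analysis.

Set Implicit Arguments.
Unset Strict Implicit.
Unset Printing Implicit Defensive.

Import Order.TTheory GRing.Theory Num.Theory.
Import numFieldNormedType.Exports.

Local Open Scope classical_set_scope.
Local Open Scope ring_scope.

Record fdist (R : realType) (T : finType) := FDist {
  pmf :> T -> R;
  pmf_ge0 : forall x, 0 <= pmf x;
  pmf_sum1 : \sum_x pmf x = 1
}.

(* The input alphabet [k] is 'I_k, and W(y | x) is [W x y]. *)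
Definition channel (R : realType) (k : nat) (Y : finType) := 'I_k -> fdist R Y.

Definition unif (R : realType) (k : nat) : 'I_k -> R := fun=> k%:R^-1.

Definition dTV (R : realType) (T : finType) (p q : T -> R) : R :=
  2^-1 * \sum_x `|p x - q x|.

Section Fluctuation.
Variables (R : realType) (k : nat) (Y : finType).

Definition output (p : 'I_k -> R) (W : channel R k Y) (y : Y) : R :=
  \sum_x p x * W x y.

Definition delta (W : channel R k Y) (p : 'I_k -> R) (y : Y) : R :=
  (output p W y - output (@unif R k) W y) / output (@unif R k) W y.

Definition delta_dot (W : channel R k Y) (p p' : 'I_k -> R) : R :=
  \sum_(y | 0 < output (@unif R k) W y)
     output (@unif R k) W y * delta W p y * delta W p' y.

(* The index space is an arbitrary measurable space and zeta an arbitrary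
   probability measure on it, so that discrete and continuous mixtures are both
   covered; measurability of z |-> p_z(x) makes the probabilities and
   expectations below meaningful. *)
Record perturbation := Perturbation {
  pert_disp : measure_display;
  pert_index : measurableType pert_disp;
  pert_dist : pert_index -> fdist R 'I_k;
  pert_measurable :
    forall x, measurable_fun [set: pert_index] (fun z => pert_dist z x);
  pert_zeta : probability pert_index R
}.

(* Membership in Upsilon_eps. *)
Definition almost_perturbation (eps : R) (P : perturbation) : Prop :=
  ((10%:R^-1)%:E <=
     pert_zeta P [set z | eps <= dTV (@pert_dist P z) (@unif R k)]%R)%E.

Definition chi2 (n : nat) (Wn : 'I_n -> channel R k Y) (P : perturbation) :
    \bar R :=
  lne ('E_(pert_zeta P \x pert_zeta P)%E
         [fun zz => expR (\sum_(i < n)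
            delta_dot (Wn i) (@pert_dist P zz.1) (@pert_dist P zz.2))])%E.

Definition minmax_chi2 (n : nat) (WW : set (channel R k Y)) (eps : R) :
    \bar R :=
  ereal_inf [set v : \bar R | exists2 P, almost_perturbation eps P &
    v = ereal_sup [set c : \bar R |
          exists2 Wn : 'I_n -> channel R k Y,
            (forall i, WW (Wn i)) & c = chi2 Wn P]].

End Fluctuation.

Lemma ltn_pair_snd (k : nat) (i : 'I_k./2) : (i.*2.+1 < k)%N.
Proof.
have le_k : (k./2.*2 <= k)%N by rewrite -{2}(odd_double_half k) leq_addl.
apply: leq_trans le_k.
by rewrite -doubleS leq_double.
Qed.

Lemma ltn_pair_fst (k : nat) (i : 'I_k./2) : (i.*2 < k)%N.
Proof. exact: ltnW (ltn_pair_snd i). Qed.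

(* With symbols numbered from 0, the i-th pair {2i-1, 2i} of [k] (1 <= i <= k/2)
   becomes {2i, 2i+1} (0 <= i < k/2). *)
Definition pair_fst (k : nat) (i : 'I_k./2) : 'I_k := Ordinal (ltn_pair_fst i).
Definition pair_snd (k : nat) (i : 'I_k./2) : 'I_k := Ordinal (ltn_pair_snd i).

Definition Hmx (R : realType) (k : nat) (Y : finType) (W : channel R k Y) :
    'M[R]_(k./2) :=
  \matrix_(i1, i2) \sum_(y | \sum_x W x y != 0)
     (W (pair_fst i1) y - W (pair_snd i1) y) *
     (W (pair_fst i2) y - W (pair_snd i2) y) / \sum_x W x y.

Definition frob (R : realType) (m n : nat) (A : 'M[R]_(m, n)) : R :=
  Num.sqrt (\sum_i \sum_j A i j ^+ 2).

(* The maximum of ||H(W)||_F over the family; it is written as a supremum, which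
   is always finite (entries of H(W) are at most 2 in absolute value) and does
   not require the maximum to be attained when the family is infinite. *)
Definition max_frobH (R : realType) (k : nat) (Y : finType)
    (WW : set (channel R k Y)) : R :=
  sup [set frob (Hmx W) | W in WW].

(* Main.v *)
(** Perturb the uniform distribution on the pairs of symbols by independent
    Rademacher signs: [p_z] gives [(1 + 2 eps z_i) / k] and [(1 - 2 eps z_i) / k]
    to the two symbols of the i-th pair. Every [p_z] is at distance [eps] from
    uniform, and the inner products become bilinear,
    [<delta_z, delta_z'> = (4 eps^2 / k) z^T H(W) z'], so the fluctuation is the
    log moment generating function of a decoupled Rademacher chaos with matrix
    [A = (4 eps^2 / k) (H(W_1) + ... + H(W_n))]. Averaging over [z], [cosh x <=
    exp (x^2)] leaves the average of [exp |A z'|^2]; averaging over the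
    coordinates of [z'] one at a time bounds this by [exp (2 |A|_F^2)] as soon
    as [|A|_F <= 1/4], which is what the hypothesis on [n] ensures. *)
Require Import Defs.
From HB Require Import structures.
From mathcomp Require Import all_boot all_order all_algebra.
From mathcomp Require Import all_classical all_reals all_analysis.
From mathcomp Require Import measurable_realfun ring lra.

Set Implicit Arguments.
Unset Strict Implicit.
Unset Printing Implicit Defensive.

Import Order.TTheory GRing.Theory Num.Theory.

Local Open Scope classical_set_scope.
Local Open Scope ring_scope.

(** * Elementary inequalities *)

(** By symmetry [x >= 0]. From [x = 1] on, both exponentials are at most [expR (x ^+ 2)]; below
    that, bounds derived from [1 + t <= expR t] leave a polynomial inequality in [x ^+ 2]. *)
Lemma expRD_expRN_le (R : realType) (x : R) :
  expR x + expR (- x) <= 2 * expR (x ^+ 2).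
Proof.
wlog x0 : x / 0 <= x.
  move=> H; have [/H //|/ltW x0] := leP 0 x.
  by rewrite addrC -sqrrN -{2}(opprK x); apply: H; rewrite oppr_ge0.
have [x1|x1] := leP 1 x.
  have h : expR x <= expR (x ^+ 2).
    by rewrite ler_expR expr2 ler_peMl.
  have h' : expR (- x) <= expR x by rewrite ler_expR; lra.
  lra.
set u := x ^+ 2.
have u0 : 0 <= u by rewrite sqr_ge0.
have u1 : u <= 1 by rewrite expr_le1 // ltW.
(* [expR t <= (1 - t / 2) ^- 2] and [(1 + u / 2) ^ 2 <= expR u] *)
have upR (t : R) : t < 2 -> expR t <= (1 - t / 2) ^- 2.
  move=> t2; have p : 0 < 1 - t / 2 by lra.
  rewrite -{1}[t]opprK expRN lef_pV2 ?posrE ?exprn_gt0 ?expR_gt0 //.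
  have -> : - t = 2%:R * - (t / 2) by lra.
  rewrite expRM_natl !expr2; have := expR_ge1Dx (- (t / 2)).
  by move=> h; apply: ler_pM; rewrite ?(ltW p).
have low : (1 + u / 2) ^+ 2 <= expR u.
  have -> : u = 2%:R * (u / 2) by lra.
  rewrite expRM_natl !expr2; have h := expR_ge1Dx (u / 2).
  by apply: ler_pM; lra.
have up : expR x + expR (- x) <= (1 - x / 2) ^- 2 + (1 - - x / 2) ^- 2.
  by apply: lerD; apply: upR; lra.
apply: (le_trans up).
suff up2 : (1 - x / 2) ^- 2 + (1 - - x / 2) ^- 2 <= 2 * (1 + u / 2) ^+ 2.
  by apply: (le_trans up2); rewrite ler_pM2l.
have p : 0 < 1 - u / 4 by lra.
have -> : (1 - x / 2) ^- 2 + (1 - - x / 2) ^- 2 =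
    2 * (1 + u / 4) / (1 - u / 4) ^+ 2.
  rewrite /u; field; rewrite /u in p; nra.
rewrite ler_pdivrMr ?exprn_gt0 //.
(* The right side minus the left is [u (1 - u) / 2 + u ^ 2 (1 - u) / 8 + u ^ 4 / 32]. *)
have : 0 <= u * (1 - u) by nra.
have : 0 <= u ^+ 2 * (1 - u) by nra.
have : 0 <= u ^+ 4 by rewrite exprn_ge0.
nra.
Qed.

(** Cauchy-Schwarz, from Lagrange's identity. *)
Lemma sum_mul_sqr_le (R : realFieldType) (I : finType) (x y : I -> R) :
  (\sum_i x i * y i) ^+ 2 <= (\sum_i x i ^+ 2) * (\sum_i y i ^+ 2).
Proof.
have : 0 <= \sum_i \sum_j (x i * y j - x j * y i) ^+ 2.
  by apply: sumr_ge0 => i _; apply: sumr_ge0 => j _; exact: sqr_ge0.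
have -> : \sum_i \sum_j (x i * y j - x j * y i) ^+ 2 =
    2 * ((\sum_i x i ^+ 2) * (\sum_i y i ^+ 2) - (\sum_i x i * y i) ^+ 2).
  transitivity (\sum_i \sum_j (x i ^+ 2 * y j ^+ 2)
      + \sum_j \sum_i (x i ^+ 2 * y j ^+ 2)
      - 2 * \sum_i \sum_j (x i * y i) * (x j * y j)).
    rewrite mulr_sumr -big_split -sumrB; apply: eq_bigr => i _ /=.
    rewrite mulr_sumr -big_split -sumrB; apply: eq_bigr => j _ /=; ring.
  have -> : \sum_j \sum_i (x i ^+ 2 * y j ^+ 2) =
      \sum_i \sum_j (x i ^+ 2 * y j ^+ 2) by rewrite exchange_big.
  rewrite !big_distrlr /= expr2 big_distrlr /=; ring.
rewrite pmulr_rge0 ?subr_ge0 //.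
Qed.

(** * Exponential moments of Rademacher sums and chaos *)

Definition flip_sign (J : finType) (j : J) (z : {ffun J -> bool}) :
  {ffun J -> bool} := [ffun i => z i (+) (i == j)].

Lemma flip_signK (J : finType) (j : J) : involutive (@flip_sign J j).
Proof. by move=> z; apply/ffunP => i; rewrite !ffunE addbK. Qed.

(** Flipping coordinate [j] is a bijection of the cube, so a bound on the average over that one sign
    passes to the whole sum. This stands in for conditioning on the other signs. *)
Lemma sum_flip_le (R : realFieldType) (J : finType) (j : J)
    (F G : {ffun J -> bool} -> R) :
  (forall z, F z + F (flip_sign j z) <= 2 * G z) ->
  \sum_z F z <= \sum_z G z.
Proof.
move=> FG; rewrite -(@ler_pM2l _ 2) //.
have -> : 2 * \sum_z F z = \sum_z (F z + F (flip_sign j z)).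
  rewrite big_split mulr_natl mulr2n /=; congr (_ + _).
  exact: (reindex_inj (inv_inj (@flip_signK J j))).
by rewrite mulr_sumr; apply: ler_sum.
Qed.

Lemma sum_flip_sign (R : realFieldType) (J : finType) (j : J) (s : seq J)
    (z : {ffun J -> bool}) (b : J -> R) : j \notin s ->
  \sum_(i <- s) (-1) ^+ flip_sign j z i * b i =
  \sum_(i <- s) (-1) ^+ z i * b i.
Proof.
move=> js; apply: eq_big_seq => i is_; rewrite ffunE.
by rewrite (_ : i == j = false) ?addbF //; apply: contraNF js => /eqP <-.
Qed.

Lemma flip_sign_id (J : finType) (j : J) (z : {ffun J -> bool}) :
  flip_sign j z j = ~~ z j.
Proof. by rewrite ffunE eqxx addbT. Qed.

Lemma expRD_signs_le (R : realType) (b : bool) (x : R) :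
  expR ((-1) ^+ b * x) + expR ((-1) ^+ (~~ b) * x) <= 2 * expR (x ^+ 2).
Proof.
case: b; rewrite /= ?expr0 ?expr1 ?mul1r ?mulN1r; last exact: expRD_expRN_le.
by rewrite addrC; exact: expRD_expRN_le.
Qed.

(** Each sign, averaged alone, costs a factor [expR (b j ^+ 2)]. The induction runs over the list of
    coordinates while [z] stays in the full cube. *)
Lemma sum_expR_signs_le (R : realType) (J : finType) (b : J -> R) (s : seq J) :
  uniq s ->
  \sum_(z : {ffun J -> bool}) expR (\sum_(j <- s) (-1) ^+ z j * b j) <=
  #|{ffun J -> bool}|%:R * expR (\sum_(j <- s) b j ^+ 2).
Proof.
elim: s => [_|j s IHs /= /andP[js us]].
  under eq_bigr do rewrite big_nil.
  by rewrite big_nil expR0 mulr1 sumr_const.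
rewrite !big_cons addrC expRD mulrA.
apply: le_trans (ler_wpM2r (expR_ge0 _) (IHs us)).
rewrite mulr_suml; apply: (@sum_flip_le _ _ j) => z.
rewrite !big_cons sum_flip_sign // flip_sign_id !expRD -mulrDl mulrC.
rewrite mulrCA; apply: ler_wpM2l; first exact: expR_ge0.
exact: expRD_signs_le.
Qed.

(* Averaging over one sign at a time turns [lam] into
   [lam + 4 lam ^ 2 |a_j| ^ 2], which stays below 2 throughout. *)
Lemma sum_expR_sqnorm_le (R : realType) (I J : finType) (a : I -> J -> R)
    (s : seq J) (lam : R) :
  uniq s -> 0 <= lam ->
  lam + 16 * (\sum_(j <- s) \sum_i a i j ^+ 2) <= 2 ->
  \sum_(z : {ffun J -> bool})
    expR (lam * \sum_i (\sum_(j <- s) (-1) ^+ z j * a i j) ^+ 2) <=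
  #|{ffun J -> bool}|%:R * expR (2 * \sum_(j <- s) \sum_i a i j ^+ 2).
Proof.
elim: s lam => [lam _ _ _|j s IHs lam /= /andP[js us] lam0].
  under eq_bigr do under eq_bigr do rewrite big_nil expr0n.
  under eq_bigr do rewrite big1 // mulr0 expR0.
  by rewrite big_nil mulr0 expR0 mulr1 sumr_const.
rewrite !big_cons; set v := \sum_i a i j ^+ 2.
set w := \sum_(k <- s) \sum_i a i k ^+ 2 => lam2.
have v0 : 0 <= v by apply: sumr_ge0 => i _; exact: sqr_ge0.
have w0 : 0 <= w.
  by apply: sumr_ge0 => k _; apply: sumr_ge0 => i _; exact: sqr_ge0.
(* As [lam <= 2], the increment [4 lam ^ 2 v] is at most [16 v]; with this new parameter the tail
   inherits the budget 2. *)
have lam'0 : 0 <= lam + 16 * v by lra.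
have lam'2 : (lam + 16 * v) + 16 * w <= 2 by lra.
rewrite mulrDr addrC expRD mulrA.
apply: le_trans (ler_wpM2r (expR_ge0 _) (IHs _ us lam'0 lam'2)).
rewrite mulr_suml; apply: (@sum_flip_le _ _ j) => z.
set S := fun i => \sum_(k <- s) (-1) ^+ z k * a i k.
pose p := \sum_i S i * a i j; pose q := \sum_i S i ^+ 2.
have sq (c : R) : \sum_i (c * a i j + S i) ^+ 2 = c ^+ 2 * v + 2 * c * p + q.
  rewrite /v /p /q !mulr_sumr -!big_split /=.
  by apply: eq_bigr => i _; ring.
under eq_bigr do rewrite big_cons.
under [X in expR _ + expR (_ * X) <= _]eq_bigr do
  rewrite big_cons sum_flip_sign // flip_sign_id.
rewrite !sq !sqrr_sign !mul1r.
(* Only the cross term [p] sees the sign at [j]. Averaging it costs [(2 lam p) ^ 2 <= 16 q v],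
   absorbed by the new parameter, while [lam v <= 2 v] goes into the final bound. *)
have pq : p ^+ 2 <= q * v by exact: sum_mul_sqr_le.
have split_exp b : expR (lam * (v + 2 * (-1) ^+ b * p + q)) =
    expR (lam * (v + q)) * expR ((-1) ^+ b * (2 * lam * p)).
  by rewrite -expRD; congr expR; ring.
rewrite !split_exp -mulrDr.
apply: (@le_trans _ _ (expR (lam * (v + q)) * (2 * expR ((2 * lam * p) ^+ 2)))).
  by rewrite ler_wpM2l ?expR_ge0 // expRD_signs_le.
rewrite mulrCA ler_pM2l // -!expRD ler_expR -/q.
have q0 : 0 <= q by apply: sumr_ge0 => i _; exact: sqr_ge0.
have h1 : lam * v <= 2 * v by apply: ler_wpM2r => //; lra.
have h2 : lam ^+ 2 * p ^+ 2 <= 4 * (q * v).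
  apply: ler_pM; rewrite ?sqr_ge0 //.
  by rewrite (_ : 4 = 2 ^+ 2) ?ler_pXn2r ?nnegrE //; [lra|ring].
have -> : (2 * lam * p) ^+ 2 = 4 * (lam ^+ 2 * p ^+ 2) by ring.
lra.
Qed.

Lemma rademacher_chaos_le (R : realType) (I J : finType) (a : I -> J -> R) :
  16 * (\sum_i \sum_j a i j ^+ 2) <= 1 ->
  \sum_(z : {ffun I -> bool}) \sum_(z' : {ffun J -> bool})
    expR (\sum_i \sum_j (-1) ^+ z i * (-1) ^+ z' j * a i j) <=
  #|{ffun I -> bool}|%:R * #|{ffun J -> bool}|%:R *
    expR (2 * \sum_i \sum_j a i j ^+ 2).
Proof.
move=> a1; rewrite exchange_big -mulrA /=.
apply: le_trans (_ : \sum_(z' : {ffun J -> bool}) #|{ffun I -> bool}|%:R *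
    expR (1 * \sum_i (\sum_(j <- index_enum J) (-1) ^+ z' j * a i j) ^+ 2) <= _).
  apply: ler_sum => z' _; rewrite mul1r.
  apply: le_trans (sum_expR_signs_le _ (index_enum_uniq _)).
  apply: ler_sum => z _; rewrite ler_expR.
  under [leRHS]eq_bigr do rewrite mulr_sumr.
  by under [leRHS]eq_bigr do under eq_bigr do rewrite mulrA.
rewrite -mulr_sumr ler_wpM2l // exchange_big /=.
(* The average over [z'] starts at [lam = 1], so the hypothesis is exactly its budget. *)
by apply: sum_expR_sqnorm_le; rewrite ?index_enum_uniq // exchange_big /=; lra.
Qed.

(** * The uniform measure on sign vectors *)

(** A named copy of the cube, to carry the discrete sigma-algebra; the bit [b] stands for the sign
    [(-1) ^+ b]. *)
Definition sign_vector (m : nat) : Type := {ffun 'I_m -> bool}.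

HB.instance Definition _ m := Finite.on (sign_vector m).
HB.instance Definition _ m :=
  isPointed.Build (sign_vector m) ([ffun=> false] : {ffun 'I_m -> bool}).
HB.instance Definition _ m :=
  @isMeasurable.Build default_measure_display (sign_vector m)
    discrete_measurable discrete_measurable0 discrete_measurableC
    discrete_measurableU.

Lemma measurable_fun_sign_vector (m : nat) (R : realType)
    (f : sign_vector m -> R) : measurable_fun [set: sign_vector m] f.
Proof. by []. Qed.

(** A normalized sum of Dirac masses, so that integration reduces to scalings, finite sums and point
    evaluations. *)
Definition sign_uniform (R : realType) (m : nat) :
    set (sign_vector m) -> \bar R :=
  mscale (#|{: sign_vector m}|%:R^-1)%:nng
    (msum (fun n => \d_(nth point (enum {: sign_vector m}) n))
      #|{: sign_vector m}|).

HB.instance Definition _ R m := Measure.on (@sign_uniform R m).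

Lemma integral_sign_uniform (R : realType) (m : nat) (f : sign_vector m -> R) :
  (forall z, 0 <= f z) ->
  (\int[@sign_uniform R m]_z (f z)%:E =
    (#|{: sign_vector m}|%:R^-1 * \sum_z f z)%:E)%E.
Proof.
move=> f0; have /measurable_EFinP mf := measurable_fun_sign_vector f.
have f0' z : [set: sign_vector m] z -> (0 <= (f z)%:E)%E by rewrite lee_fin.
rewrite ge0_integral_mscale // ge0_integral_measure_sum //=.
rewrite EFinM -sumEFin; congr (_ * _)%E.
rewrite -[in RHS]big_enum (big_nth point) -cardE big_mkord; apply: eq_bigr => i _.
by rewrite integral_dirac // diracT mul1e.
Qed.

Lemma sign_uniform_setT (R : realType) (m : nat) :
  @sign_uniform R m setT = 1%E.
Proof.
rewrite -(mul1e (sign_uniform _ _)) -integral_cst //.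
rewrite (integral_sign_uniform (f := cst 1)) //= sumr_const mulVf // pnatr_eq0.
by rewrite -lt0n; apply/card_gt0P; exists point.
Qed.

HB.instance Definition _ R m := Measure_isProbability.Build _ _ _
  (@sign_uniform R m) (sign_uniform_setT R m).

Lemma expectation_sign_uniform_pair (R : realType) (m : nat)
    (f : sign_vector m * sign_vector m -> R) :
  measurable_fun [set: sign_vector m * sign_vector m] f ->
  (forall zz, 0 <= f zz) ->
  ('E_(@sign_uniform R m \x @sign_uniform R m)[f] =
    (#|{: sign_vector m}|%:R^-2 * \sum_z \sum_z' f (z, z'))%:E)%E.
Proof.
move=> mf f0; rewrite unlock.
have mf' : measurable_fun [set: sign_vector m * sign_vector m] (EFin \o f).
  exact/measurable_EFinP.
rewrite fubini_tonelli1 //=.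
pose F z := #|{: sign_vector m}|%:R^-1 * \sum_z' f (z, z').
have -> : fubini_F (@sign_uniform R m) (EFin \o f) = EFin \o F.
  by apply/funext => z; rewrite /fubini_F integral_sign_uniform.
rewrite integral_sign_uniform => [|z].
  by rewrite -mulr_sumr mulrA -exprVn.
by rewrite mulr_ge0 ?invr_ge0 ?sumr_ge0.
Qed.

(** Cauchy-Schwarz against the constant 1, for the sums over the [n] channels. *)
Lemma sqr_sum_le (R : realFieldType) (I : finType) (x : I -> R) :
  (\sum_i x i) ^+ 2 <= #|I|%:R * \sum_i x i ^+ 2.
Proof.
have := sum_mul_sqr_le x (fun=> 1).
under eq_bigr do rewrite mulr1.
by rewrite expr1n sumr_const mulrC.
Qed.

(** * The paired perturbation and its inner products *)

Lemma pair_cases (k : nat) (x : 'I_k) : ~~ odd k ->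
  exists i, x = pair_fst i \/ x = pair_snd i.
Proof.
move=> ek; have lt_x : (x./2 < k./2)%N by rewrite ltn_half_double even_halfK.
exists (Ordinal lt_x); case: (boolP (odd x)) => ox; [right | left];
  by apply: val_inj => /=; rewrite -{1}(odd_double_half x) ?ox ?(negPf ox).
Qed.

(** At most one term is nonzero: the sign of the pair containing [x], negated on its second symbol.
    The sum form turns summation over symbols into an exchange of sums. *)
Definition pair_sign (R : realType) (k : nat) (z : sign_vector k./2)
    (x : 'I_k) : R :=
  \sum_i (-1) ^+ (z : {ffun _ -> _}) i *
    ((x == pair_fst i)%:R - (x == pair_snd i)%:R).

Lemma norm_pair_sign (R : realType) (k : nat) (z : sign_vector k./2)
    (x : 'I_k) : ~~ odd k -> `|pair_sign R z x| = 1.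
Proof.
move=> ek; have [i xi] := pair_cases x ek.
(* First symbols are even and second ones odd, so they never coincide. *)
have even_odd (a b : nat) : (a.*2 == b.*2.+1)%N = false.
  by apply/eqP => /(congr1 odd); rewrite /= !odd_double.
rewrite /pair_sign (bigD1 i) //= big1 ?addr0 => [|j ji].
  rewrite normrM normr_sign mul1r.
  by case: xi => ->; rewrite -!val_eqE /= eqxx ?even_odd ?(eq_sym _.+1) ?even_odd
    ?subr0 ?sub0r ?normrN1 ?normr1.
have ij : (i.*2 == j.*2)%N = false.
  by apply: contraNF ji; rewrite -!muln2 eqn_pmul2r // => /eqP ij; apply/eqP/val_inj.
by case: xi => ->; rewrite -!val_eqE /= ?eqSS ij ?even_odd ?(eq_sym _.+1)
  ?even_odd subrr mulr0.
Qed.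

Lemma sum_pair_sign (R : realType) (k : nat) (z : sign_vector k./2)
    (f : 'I_k -> R) :
  \sum_x pair_sign R z x * f x =
  \sum_i (-1) ^+ (z : {ffun _ -> _}) i * (f (pair_fst i) - f (pair_snd i)).
Proof.
rewrite /pair_sign; under eq_bigr do rewrite mulr_suml.
rewrite exchange_big; apply: eq_bigr => i _ /=.
under eq_bigr do rewrite -mulrA mulrBl.
rewrite -mulr_sumr sumrB; congr (_ * (_ - _)).
  by rewrite (bigD1 (pair_fst i)) //= eqxx mul1r big1 ?addr0 // => x /negPf ->;
    rewrite mul0r.
by rewrite (bigD1 (pair_snd i)) //= eqxx mul1r big1 ?addr0 // => x /negPf ->;
  rewrite mul0r.
Qed.

Definition paired_pmf (R : realType) (k : nat) (eps : R) (z : sign_vector k./2)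
    (x : 'I_k) : R :=
  k%:R^-1 * (1 + 2 * eps * pair_sign R z x).

Lemma paired_pmf_ge0 (R : realType) (k : nat) (eps : R) (z : sign_vector k./2)
    (x : 'I_k) : ~~ odd k -> 0 < eps <= 2^-1 -> 0 <= paired_pmf eps z x.
Proof.
move=> ek /andP[e0 e1]; rewrite mulr_ge0 ?invr_ge0 //.
have : `|2 * eps * pair_sign R z x| <= 1.
  by rewrite normrM norm_pair_sign // mulr1 ger0_norm; lra.
by rewrite ler_norml => /andP[h _]; lra.
Qed.

Lemma sum_paired_pmf (R : realType) (k : nat) (eps : R)
    (z : sign_vector k./2) (f : 'I_k -> R) :
  \sum_x paired_pmf eps z x * f x = k%:R^-1 * \sum_x f x +
    2 * eps / k%:R *
    \sum_i (-1) ^+ (z : {ffun _ -> _}) i * (f (pair_fst i) - f (pair_snd i)).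
Proof.
rewrite -sum_pair_sign !mulr_sumr -big_split; apply: eq_bigr => x _ /=.
by rewrite /paired_pmf; ring.
Qed.

Lemma sum_paired_pmf1 (R : realType) (k : nat) (eps : R)
    (z : sign_vector k./2) : (2 <= k)%N -> \sum_x paired_pmf eps z x = 1.
Proof.
move=> k2; have := sum_paired_pmf eps z (fun=> 1).
under eq_bigr do rewrite mulr1.
move=> ->; rewrite [X in _ + _ * X]big1 => [|i _]; last by rewrite subrr mulr0.
by rewrite mulr0 addr0 sumr_const card_ord mulVf // pnatr_eq0 -lt0n ltnW.
Qed.

(** Each of the [k] symbols deviates from [1 / k] by exactly [2 eps / k], and total variation halves
    the sum. *)
Lemma dTV_paired_pmf (R : realType) (k : nat) (eps : R)
    (z : sign_vector k./2) : (2 <= k)%N -> ~~ odd k -> 0 < eps ->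
  dTV (paired_pmf eps z) (@unif R k) = eps.
Proof.
move=> k2 ek e0; have k0 : k%:R != 0 :> R by rewrite pnatr_eq0 -lt0n ltnW.
rewrite /dTV (eq_bigr (fun=> 2 * eps / k%:R)) => [|x _].
  by rewrite sumr_const card_ord -[_ *+ k]mulr_natr; field.
rewrite (_ : _ - _ = 2 * eps / k%:R * pair_sign R z x); last first.
  by rewrite /paired_pmf /unif; ring.
rewrite normrM norm_pair_sign // mulr1 ger0_norm //.
by rewrite mulr_ge0 ?invr_ge0 // mulr_ge0 // ltW.
Qed.

Lemma delta_dot_paired_pmf (R : realType) (k : nat) (Y : finType)
    (W : channel R k Y) (eps : R) (z z' : sign_vector k./2) : (2 <= k)%N ->
  delta_dot W (paired_pmf eps z) (paired_pmf eps z') =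
  4 * eps ^+ 2 / k%:R *
    \sum_i \sum_j (-1) ^+ (z : {ffun _ -> _}) i *
      (-1) ^+ (z' : {ffun _ -> _}) j * Hmx W i j.
Proof.
move=> k2; have k0 : k%:R != 0 :> R by rewrite pnatr_eq0 -lt0n ltnW.
have kp : 0 < k%:R^-1 :> R by rewrite invr_gt0 ltr0n ltnW.
pose s y := \sum_x W x y; pose D i y := W (pair_fst i) y - W (pair_snd i) y.
pose T (w : sign_vector k./2) y := \sum_i (-1) ^+ (w : {ffun _ -> _}) i * D i y.
have s0 y : 0 <= s y by apply: sumr_ge0 => x _; exact: Defs.pmf_ge0.
have uE y : output (@unif R k) W y = k%:R^-1 * s y.
  by rewrite /output -mulr_sumr.
have dE w y : delta W (paired_pmf eps w) y =
    2 * eps / k%:R * T w y / (k%:R^-1 * s y).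
  by rewrite /delta /output sum_paired_pmf -/(s y) -/(output _ W y) uE addrC addKr.
rewrite /delta_dot.
(* The outputs kept by [delta_dot] are those with nonzero denominator in [Hmx]. *)
rewrite (eq_bigl (fun y => s y != 0)) => [|y]; last first.
  by rewrite uE pmulr_rgt0 // lt0r s0 andbT.
transitivity (\sum_(y | s y != 0)
    4 * eps ^+ 2 / k%:R * (T z y * T z' y / s y)).
  by apply: eq_bigr => y sy; rewrite uE !dE; field; rewrite sy k0.
rewrite -mulr_sumr; congr (_ * _).
under eq_bigr do rewrite /T big_distrlr mulr_suml.
rewrite exchange_big; apply: eq_bigr => i _ /=.
under eq_bigr do rewrite mulr_suml.
rewrite exchange_big; apply: eq_bigr => j _ /=.
by rewrite mxE mulr_sumr; apply: eq_bigr => y _; rewrite /D -/(s y); ring.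
Qed.

(** * Frobenius norms over the family *)

(** One difference is dominated by the denominator, the other sums over [y] to at most 2. This
    bounds the set whose [sup] is [max_frobH]. *)
Lemma Hmx_norm_le (R : realType) (k : nat) (Y : finType) (W : channel R k Y) i j :
  `|Hmx W i j| <= 2.
Proof.
rewrite mxE; apply: le_trans (ler_norm_sum _ _ _) _.
have W0 x y : 0 <= W x y by exact: Defs.pmf_ge0.
pose s y := \sum_x W x y.
have Ws x y : W x y <= s y.
  by rewrite /s (bigD1 x) //= lerDl sumr_ge0.
apply: (@le_trans _ _ (\sum_y (W (pair_fst j) y + W (pair_snd j) y))).
  rewrite [leRHS](bigID (fun y => s y != 0)) /= -[leLHS]addr0.
  apply: lerD; last by apply: sumr_ge0 => y _; rewrite addr_ge0.
  apply: ler_sum => y sy; have sp : 0 < s y by rewrite lt0r sy sumr_ge0.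
  rewrite -/(s y) !normrM normfV (gtr0_norm sp) ler_pdivrMr // mulrC.
  apply: ler_pM => //; rewrite ler_norml.
    by move: (W0 (pair_fst j) y) (W0 (pair_snd j) y); lra.
  move: (W0 (pair_fst i) y) (W0 (pair_snd i) y).
  by move: (Ws (pair_fst i) y) (Ws (pair_snd i) y); lra.
by rewrite big_split /= !Defs.pmf_sum1.
Qed.

Lemma frob_ge0 (R : realType) (m n : nat) (A : 'M[R]_(m, n)) : 0 <= frob A.
Proof. exact: sqrtr_ge0. Qed.

Lemma sqr_frob (R : realType) (m n : nat) (A : 'M[R]_(m, n)) :
  frob A ^+ 2 = \sum_i \sum_j A i j ^+ 2.
Proof.
by rewrite sqr_sqrtr // sumr_ge0 // => i _; rewrite sumr_ge0 // => j _; rewrite sqr_ge0.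
Qed.

Lemma frob_le_max_frobH (R : realType) (k : nat) (Y : finType)
    (WW : set (channel R k Y)) (W : channel R k Y) :
  WW W -> frob (Hmx W) <= max_frobH WW.
Proof.
move=> WWW; apply: ub_le_sup; last by exists W.
exists (Num.sqrt (\sum_(i < k./2) \sum_(j < k./2) 2 ^+ 2)) => _ [V _ <-].
apply: ler_wsqrtr; apply: ler_sum => i _; apply: ler_sum => j _.
by rewrite -(real_normK (num_real (Hmx V i j))) ler_pXn2r ?nnegrE // Hmx_norm_le.
Qed.

Lemma max_frobH_ge0 (R : realType) (k : nat) (Y : finType)
    (WW : set (channel R k Y)) : 0 <= max_frobH WW.
Proof.
rewrite /max_frobH.
(* For an empty family [sup] takes its default value 0. *)
have [->|/set0P[W WWW]] := eqVneq WW set0; first by rewrite image_set0 sup0.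
exact: le_trans (frob_ge0 _) (frob_le_max_frobH WWW).
Qed.

(** Entrywise Cauchy-Schwarz over the [n] channels replaces the triangle inequality for the
    Frobenius norm. *)
Lemma sum_sqr_sum_Hmx_le (R : realType) (k n : nat) (Y : finType)
    (WW : set (channel R k Y)) (Wn : 'I_n -> channel R k Y) :
  (forall t, WW (Wn t)) ->
  \sum_i \sum_j (\sum_t Hmx (Wn t) i j) ^+ 2 <= (n%:R * max_frobH WW) ^+ 2.
Proof.
move=> WWn; apply: (@le_trans _ _ (n%:R * \sum_t frob (Hmx (Wn t)) ^+ 2)).
  under [X in _ <= _ * X]eq_bigr do rewrite sqr_frob.
  rewrite [X in _ <= _ * X]exchange_big mulr_sumr; apply: ler_sum => i _ /=.
  rewrite [X in _ <= _ * X]exchange_big mulr_sumr; apply: ler_sum => j _ /=.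
  by have := sqr_sum_le (fun t => Hmx (Wn t) i j); rewrite card_ord.
rewrite exprMn expr2 -mulrA ler_wpM2l //.
have -> : n%:R * max_frobH WW ^+ 2 = \sum_(t < n) max_frobH WW ^+ 2.
  by rewrite sumr_const card_ord mulr_natl.
apply: ler_sum => t _.
by rewrite ler_pXn2r ?nnegrE ?frob_ge0 ?max_frobH_ge0 // frob_le_max_frobH.
Qed.

(** * Fluctuation of the paired perturbation *)

Lemma measurable_delta_dot (R : realType) (k : nat) (Y : finType)
    (d : measure_display) (T : measurableType d) (p : T -> 'I_k -> R)
    (W : channel R k Y) : (forall x, measurable_fun [set: T] (p ^~ x)) ->
  measurable_fun [set: T * T] (fun zz => delta_dot W (p zz.1) (p zz.2)).
Proof.
move=> mp.
(* [g] will be either projection. *)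
have mdelta (g : T * T -> T) y : measurable_fun [set: T * T] g ->
    measurable_fun [set: T * T] (fun zz => delta W (p (g zz)) y).
  move=> mg; rewrite /delta /output.
  apply: measurable_funM => //; apply: measurable_funB => //.
  apply: measurable_sum => x; apply: measurable_funM => //.
  exact: (measurableT_comp (mp x)).
rewrite /delta_dot; under eq_fun do rewrite big_mkcond.
apply: measurable_sum => y; case: (0 < output _ W y) => //.
by apply: measurable_funM; [apply: measurable_funM => //|]; apply: mdelta.
Qed.

Definition paired_fdist (R : realType) (k : nat) (eps : R) (k2 : (2 <= k)%N)
    (ek : ~~ odd k) (he : 0 < eps <= 2^-1) (z : sign_vector k./2) :
    fdist R 'I_k :=
  FDist (fun x => paired_pmf_ge0 z x ek he) (sum_paired_pmf1 eps z k2).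

Definition paired_perturbation (R : realType) (k : nat) (eps : R)
    (k2 : (2 <= k)%N) (ek : ~~ odd k) (he : 0 < eps <= 2^-1) :
    perturbation R k :=
  @Perturbation R k _ (sign_vector k./2) (paired_fdist k2 ek he)
    (fun x => measurable_fun_sign_vector _)
    (@sign_uniform R k./2).

Lemma almost_perturbation_paired (R : realType) (k : nat) (eps : R)
    (k2 : (2 <= k)%N) (ek : ~~ odd k) (he : 0 < eps <= 2^-1) :
  almost_perturbation eps (paired_perturbation k2 ek he).
Proof.
rewrite /almost_perturbation /=.
rewrite (_ : [set z | _] = setT); last first.
  apply/seteqP; split => // z _ /=.
  by case/andP: (he) => e0 _; rewrite (dTV_paired_pmf z k2 ek e0).
by rewrite sign_uniform_setT lee_fin; lra.
Qed.

Lemma chi2_paired_le (R : realType) (k n : nat) (Y : finType) (eps : R)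
    (WW : set (channel R k Y)) (Wn : 'I_n -> channel R k Y)
    (k2 : (2 <= k)%N) (ek : ~~ odd k) (he : 0 < eps <= 2^-1) :
  (forall t, WW (Wn t)) ->
  16 * eps ^+ 2 * max_frobH WW * n%:R <= k%:R ->
  (chi2 Wn (paired_perturbation k2 ek he) <=
    (32 * ((n%:R ^+ 2 * eps ^+ 4 / k%:R) * (max_frobH WW ^+ 2 / k%:R)))%:E)%E.
Proof.
move=> WWn hn; set M := max_frobH WW in hn *; set B := 32 * _.
have k0 : 0 < k%:R :> R by rewrite ltr0n ltnW.
have M0 : 0 <= M by exact: max_frobH_ge0.
pose c := 4 * eps ^+ 2 / k%:R.
pose a i j := c * \sum_t Hmx (Wn t) i j.
have c0 : 0 <= c by rewrite /c mulr_ge0 ?invr_ge0 ?(ltW k0) // mulr_ge0 ?sqr_ge0.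
have a_le : \sum_i \sum_j a i j ^+ 2 <= (c * (n%:R * M)) ^+ 2.
  rewrite exprMn; apply: le_trans (ler_wpM2l (sqr_ge0 c) (sum_sqr_sum_Hmx_le WWn)).
  rewrite mulr_sumr; apply: ler_sum => i _; rewrite mulr_sumr.
  by apply: ler_sum => j _; rewrite /a exprMn.
(* This is the hypothesis on [n], divided by [4 k]. *)
have c_le : c * (n%:R * M) <= 4^-1.
  by rewrite /c mulrAC ler_pdivrMr //; lra.
have a16 : 16 * (\sum_i \sum_j a i j ^+ 2) <= 1.
  have : (c * (n%:R * M)) ^+ 2 <= 4^-1 ^+ 2.
    have nM0 : 0 <= c * (n%:R * M) by rewrite mulr_ge0 // mulr_ge0.
    by rewrite ler_pXn2r ?nnegrE ?invr_ge0.
  lra.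
(* The constant 32 is the 2 of the chaos bound times the square of the 4 in [c]. *)
have BE : 2 * (c * (n%:R * M)) ^+ 2 = B.
  by rewrite /B /c; field; rewrite gt_eqF.
pose f (zz : sign_vector k./2 * sign_vector k./2) := expR (\sum_(t < n)
  delta_dot (Wn t) (paired_pmf eps zz.1) (paired_pmf eps zz.2)).
have fE z z' : f (z, z') = expR (\sum_i \sum_j
    (-1) ^+ (z : {ffun _ -> _}) i * (-1) ^+ (z' : {ffun _ -> _}) j * a i j).
  rewrite /f /=; congr expR; under eq_bigr do rewrite delta_dot_paired_pmf //.
  rewrite -mulr_sumr exchange_big mulr_sumr; apply: eq_bigr => i _ /=.
  rewrite exchange_big mulr_sumr; apply: eq_bigr => j _ /=.
  by rewrite /a -mulr_sumr mulrCA.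
have mf : measurable_fun [set: sign_vector k./2 * sign_vector k./2] f.
  apply: measurableT_comp; first exact: measurable_expR.
  by apply: measurable_sum => t; apply: measurable_delta_dot.
rewrite /chi2 /= (expectation_sign_uniform_pair mf) => [|zz]; last exact: expR_ge0.
set E := _ * _.
have E_le : E <= expR B.
  have N0 : 0 < #|{: sign_vector k./2}|%:R ^+ 2 :> R.
    by rewrite exprn_gt0 // ltr0n; apply/card_gt0P; exists point.
  rewrite /E mulrC ler_pdivrMr //.
  under eq_bigr do under eq_bigr do rewrite fE.
  apply: le_trans (rademacher_chaos_le a16) _.
  rewrite -expr2 mulrC ler_wpM2r ?(ltW N0) // ler_expR -BE; lra.
(* Writing [B] as the logarithm of its exponential, monotonicity of [lne] on nonnegative values
   concludes. *)
rewrite -(expeRK B%:E) lee_lne ?lee_fin // in_itv /= leey andbT lee_fin ?expR_ge0 //.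
by rewrite mulr_ge0 ?invr_ge0 ?exprn_ge0 // sumr_ge0 // => z _;
  rewrite sumr_ge0 // => z' _; exact: expR_ge0.
Qed.

(* The quotient in the hypothesis is taken in \bar R, where k / 0 = +oo: there
   is no constraint on n when H vanishes on the whole family. The range of eps is that of the perturbations
   ((1 + 2 eps z_i) / k, (1 - 2 eps z_i) / k), z in {-1,1}^(k/2), which stay
   distributions up to eps = 1/2; for eps in (1/2, 1) no constant C exists (for
   instance no distribution on two symbols is at distance eps from uniform). *)
Theorem theorem4p11 (R : realType) :
  exists2 C : R, 0 < C &
    forall (k n : nat) (eps : R) (Y : finType) (WW : set (channel R k Y)),
      (2 <= k)%N -> ~~ odd k ->
      0 < eps <= 2^-1 ->
      (n%:R%:E <= k%:R%:E / (16%:R * eps ^+ 2 * max_frobH WW)%:E)%E ->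
      (minmax_chi2 n WW eps <=
        (C * ((n%:R ^+ 2 * eps ^+ 4 / k%:R) *
              (max_frobH WW ^+ 2 / k%:R)))%:E)%E.
Proof.
exists 32 => // k n eps Y WW k2 ek he hn.
have M0 := max_frobH_ge0 WW; have /andP[e0 _] := he.
have hn' : 16 * eps ^+ 2 * max_frobH WW * n%:R <= k%:R.
  have [->|Mn0] := eqVneq (max_frobH WW) 0; first by rewrite mulr0 mul0r.
  have p : 0 < 16 * eps ^+ 2 * max_frobH WW.
    by rewrite mulr_gt0 ?mulr_gt0 ?exprn_gt0 // lt0r Mn0.
  move: hn; rewrite inver gt_eqF // lee_pdivlMr // lee_fin.
  by rewrite [n%:R * _]mulrC.
(* A single perturbation, fixed before the channels, bounds the infimum; its fluctuation bound is
   uniform in [Wn]. *)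
apply: ereal_inf_le; eexists.
  by exists (paired_perturbation k2 ek he) => //; exact: almost_perturbation_paired.
by apply: ge_ereal_sup => _ [Wn WWn ->]; exact: chi2_paired_le.
Qed.
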